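(* Let $f,g:\mathbb{R}^n\times[0,\infty)\to\mathbb{R}^n$ satisfy the local Lipschitz condition stated in the context, and suppose that there exist positive constants $K_1$ and $C$ such that for all $t>0$ and all $x\in\mathbb{R}^n$ $$|f(x,t)|\le K_1(1+t)^{-1}|x|,\qquad \langle x,f(x,t)\rangle\le -K_1(1+t)^{-1}|x|^2,\qquad |g(x,t)|\le C(1+t)^{-K_1}.$$ If $K_1\ge 1$ and $0<\Delta t<(2+K_1)^{-1}$, then for any initial value $Y_0=x(0)\in\mathbb{R}^n$ the Euler--Maruyama solution $(Y_k)_{k\ge 0}$ defined by $$Y_{k+1}=Y_k+f(Y_k,k\Delta t)\,\Delta t+g(Y_k,k\Delta t)\,\Delta B_k,\qquad k=0,1,2,\dots,$$ satisfies $$\limsup_{k\to\infty}\frac{\log \mathbb{E}|Y_k|^2}{\log (k\Delta t)}\le -(2K_1-1).$$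
   Context: $(\Omega,\mathcal{F},\{\mathcal{F}_t\}_{t\ge 0},\mathbb{P})$ is a complete probability space with a filtration that is increasing and right continuous, with $\mathcal{F}_0$ containing all $\mathbb{P}$-null sets; $B(t)$ is a scalar Brownian motion on it; $|\cdot|$ is the Euclidean norm and $\langle\cdot,\cdot\rangle$ the inner product on $\mathbb{R}^n$. The scheme approximates the It\^o SDE $dx(t)=f(x(t),t)\,dt+g(x(t),t)\,dB(t)$, $t\ge 0$, with deterministic initial value $x(0)\in\mathbb{R}^n$. $\Delta t>0$ is the time step and $\Delta B_k=B((k+1)\Delta t)-B(k\Delta t)$. Local Lipschitz condition: for every integer $r\ge 1$ and any $t\ge 0$ there is a positive constant $\bar K_{r,t}$ such that for all $x,y\in\mathbb{R}^n$ with $\max(|x|,|y|)\le r$, $\max(|f(x,t)-f(y,t)|^2,|g(x,t)-g(y,t)|^2)\le \bar K_{r,t}|x-y|^2$. Convention: $\log 0=-\infty$. *)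

(* Defs.v *)
From mathcomp Require Import all_boot all_order all_algebra.
From mathcomp Require Import all_classical all_reals all_analysis.
Import Order.TTheory GRing.Theory Num.Theory.
Import numFieldNormedType.Exports.
Set Implicit Arguments.
Unset Strict Implicit.
Unset Printing Implicit Defensive.
Local Open Scope classical_set_scope.
Local Open Scope ring_scope.

Definition dotp (R : realType) (n : nat) (x y : 'rV[R]_n) : R :=
  \sum_(i < n) x 0 i * y 0 i.

(* The norm `|x| of MathComp-Analysis on row vectors is the max norm. *)
Definition enorm (R : realType) (n : nat) (x : 'rV[R]_n) : R :=
  Num.sqrt (dotp x x).

(* Time runs over R; everything below is constrained only on [0, +oo[. *)

Record usual_filtration (d : measure_display) (T : measurableType d)
    (R : realType) (P : probability T R) (F : R -> set (set T)) : Prop := {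
  filtration_sigma_algebra :
    forall t, 0 <= t -> sigma_algebra [set: T] (F t) ;
  filtration_measurable :
    forall t, 0 <= t -> F t `<=` measurable ;
  filtration_nondecreasing :
    forall s t, 0 <= s -> s <= t -> F s `<=` F t ;
  filtration_right_continuous :
    forall t, 0 <= t -> F t = \bigcap_(s in `]t, +oo[) F s ;
  filtration_negligible :
    P.-negligible `<=` F 0 }.

Record brownian_motion (d : measure_display) (T : measurableType d)
    (R : realType) (P : probability T R) (F : R -> set (set T))
    (B : R -> T -> R) : Prop := {
  brownian_adapted :
    forall (t : R) (U : set R), 0 <= t -> measurable U -> F t (B t @^-1` U) ;
  brownian_start : {ae P, forall w, B 0 w = 0} ;
  brownian_continuous :
    {ae P, forall w, {within `[0, +oo[, continuous (fun t : R => B t w)}} ;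
  (* the second parameter of normal_prob is the standard deviation *)
  brownian_increment_normal :
    forall (s t : R) (U : set R), 0 <= s -> s < t -> measurable U ->
      P ((fun w => B t w - B s w) @^-1` U) = normal_prob 0 (Num.sqrt (t - s)) U ;
  brownian_increment_independent :
    forall (s t : R) (A : set T) (U : set R),
      0 <= s -> s < t -> F s A -> measurable U ->
      P (A `&` (fun w => B t w - B s w) @^-1` U) =
      (P A * P ((fun w => (B t w - B s w)%R) @^-1` U))%E }.

Definition local_lipschitz (R : realType) (n : nat)
    (f g : 'rV[R]_n -> R -> 'rV[R]_n) : Prop :=
  forall (r : nat) (t : R), (1 <= r)%N -> 0 <= t ->
  exists2 K : R, 0 < K &
    forall x y : 'rV[R]_n, Num.max (enorm x) (enorm y) <= r%:R ->
      Num.max (enorm (f x t - f y t) ^+ 2) (enorm (g x t - g y t) ^+ 2)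
      <= K * enorm (x - y) ^+ 2.

Fixpoint euler_maruyama (R : realType) (n : nat) (T : Type)
    (f g : 'rV[R]_n -> R -> 'rV[R]_n) (B : R -> T -> R) (dt : R)
    (y0 : 'rV[R]_n) (k : nat) (w : T) {struct k} : 'rV[R]_n :=
  if k is j.+1 then
    let Y := euler_maruyama f g B dt y0 j w in
    Y + dt *: f Y (j%:R * dt)
      + (B (j.+1%:R * dt) w - B (j%:R * dt) w) *: g Y (j%:R * dt)
  else y0.

(* Main.v *)
Require Import Defs.
From HB Require Import structures.
From mathcomp Require Import all_boot all_order all_algebra.
From mathcomp Require Import all_classical all_reals all_analysis.
From mathcomp Require Import measurable_realfun.
From mathcomp Require Import ring lra.
Import Order.TTheory GRing.Theory Num.Theory.
Import numFieldNormedType.Exports.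
Set Implicit Arguments.
Unset Strict Implicit.
Unset Printing Implicit Defensive.
Local Open Scope classical_set_scope.
Local Open Scope ring_scope.

(** Write $Y_k$ for the Euler--Maruyama iterates, $D_k$ for the Brownian
    increments, $t_k = 1 + k\Delta t$ and $a_k = E|Y_k|^2$.

    Mean-square recursion. Since $Y_k$ is measurable with respect to
    $F_{k\Delta t}$ and $D_k$ is independent of that sigma-algebra and
    centred, the cross term in $|Y_k + f\Delta t + g D_k|^2$ has mean zero.
    The proof obtains this by reflection: $D_k$ is symmetric, so
    $E|u + D_k v|^2 = E|u - D_k v|^2$ for adapted $u$, $v$
    ([integral_indep_symmetric]), and the parallelogram identity for the two
    sides gives $E|u + D_k v|^2 = E|u|^2 + E(D_k^2|v|^2)$. All integrands are
    nonnegative, hence this makes sense in the extended reals; it remains to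
    bound $|v|^2$ and to know that $M = E D_k^2$ is finite
    ([expectation_sqr_indep_le], [normal_prob_moment2_lty]). The two
    drift conditions give
    $$|x + f(x,t)\Delta t|^2 \le (1 - K_1\Delta t/(1+t))^2 |x|^2$$
    ([sqr_enorm_drift_le]), and therefore for $k \ge 1$
    $$a_{k+1} \le (1 - K_1\Delta t/t_k)^2 a_k + C^2 M\, t_k^{-2K_1}.$$

    Solving the recursion. By Bernoulli's inequality
    $1 - K_1 s \le (1+s)^{-K_1}$ with $s = \Delta t/t_k$, so that
    $(1 - K_1\Delta t/t_k)^2 t_k^{-2K_1} \le t_{k+1}^{-2K_1}$
    ([contraction_powR]): the sequence $a_k t_k^{2K_1}$ increases by at most a
    constant at each step and grows at most linearly
    ([linear_growth_powR_bound]). Hence $a_k \le M' t_k^{-(2K_1-1)}$, and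
    taking logarithms gives the limsup ([limn_esup_ln_ratio_le]).

    The growth conditions say nothing about time $0$, but $Y_0$ is
    deterministic, so $a_1$ is finite and the recursion starts at $k = 1$. *)

(** * The normal law: symmetry and second moment *)

Lemma normal_prob_opp (R : realType) (s : R) (U : set R) : s != 0 ->
  measurable U -> normal_prob 0 s (-%R @^-1` U) = normal_prob 0 s U.
Proof.
move=> s0 mU; rewrite /normal_prob.
have mpdf : measurable_fun setT (EFin \o @normal_pdf R 0 s).
  by apply/measurable_EFinP; exact: measurable_normal_pdf.
transitivity (\int[pushforward (@lebesgue_measure R)
    (-%R : measurableTypeR R -> measurableTypeR R)]_(x in U)
    (normal_pdf 0 s x)%:E)%E.
  rewrite ge0_integral_pushforward//.
  - apply: eq_integral => x _ /=.
    by rewrite normal_pdfE// /normal_fun !subr0 sqrrN.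
  - exact: measurable_funS mpdf.
  - by move=> x _; rewrite lee_fin normal_pdf_ge0.
apply: eq_measure_integral => A mA _; exact: lebesgue_measureN.
Qed.

(** The density of the normal law and the Radon--Nikodym derivative supplied
    by [normal_prob_dominates] have the same integral over every measurable
    set, hence agree almost everywhere. *)
Lemma ge0_integral_normal_prob (R : realType) (m s : R) (f : R -> \bar R) :
  (forall x, 0 <= f x)%E -> measurable_fun setT f ->
  (\int[normal_prob m s]_x f x =
   \int[lebesgue_measure]_x (f x * (normal_pdf m s x)%:E))%E.
Proof.
move=> f0 mf.
have dom := normal_prob_dominates m s.
rewrite -(Radon_Nikodym_SigmaFinite.change_of_variables dom f0 measurableT mf).
have mpdf : measurable_fun setT (EFin \o @normal_pdf R m s).
  by apply/measurable_EFinP; exact: measurable_normal_pdf.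
have idn := Radon_Nikodym_SigmaFinite.f_integrable dom.
apply: ae_eq_integral => //.
- by apply: emeasurable_funM => //; exact: measurable_int idn.
- by apply: emeasurable_funM.
- apply: ae_eqe_mul2l; apply: integral_ae_eq => //.
  by move=> E _ mE; rewrite -Radon_Nikodym_SigmaFinite.f_integral.
Qed.

(** The elementary bound $u e^{-u} \le 1$ with $u = x^2/(4s^2)$ dominates
    $x^2$ times the density of standard deviation $s$ by a multiple of the
    density of standard deviation $\sqrt 2 s$, whose integral is $1$. *)
Lemma normal_prob_moment2_lty (R : realType) (s : R) : s != 0 ->
  (\int[normal_prob 0 s]_x (x ^+ 2)%:E < +oo)%E.
Proof.
move=> s0.
rewrite ge0_integral_normal_prob; last 2 first.
- by move=> x; rewrite lee_fin sqr_ge0.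
- by apply/measurable_EFinP; exact: measurable_funX.
pose s' := Num.sqrt 2 * s.
have s'0 : s' != 0 by rewrite mulf_neq0// sqrtr_eq0 -ltNge.
have s'2 : s' ^+ 2 = 2 * s ^+ 2 by rewrite exprMn sqr_sqrtr.
have s2 : 0 < s ^+ 2 by rewrite exprn_even_gt0.
pose c := normal_peak s / normal_peak s' * (4 * s ^+ 2).
have pk := normal_peak_gt0 s0; have pk' := normal_peak_gt0 s'0.
have c0 : 0 <= c.
  by apply: mulr_ge0; [apply: divr_ge0; exact: ltW|
    apply: mulr_ge0 => //; exact: ltW].
apply: (@le_lt_trans _ _ (\int[lebesgue_measure]_x
    (c%:E * (normal_pdf 0 s' x)%:E)))%E; last first.
  rewrite ge0_integralZl//=.
  - by rewrite integral_normal_pdf mule1 ltry.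
  - by apply/measurable_EFinP; exact: measurable_normal_pdf.
  - by move=> x _; rewrite lee_fin normal_pdf_ge0.
apply: ge0_le_integral => //=.
- by move=> x _; rewrite mule_ge0// lee_fin ?sqr_ge0 ?normal_pdf_ge0.
- apply/measurable_EFinP; apply: measurable_funM; first exact: measurable_funX.
  exact: measurable_normal_pdf.
- apply/measurable_EFinP; apply: measurable_funM => //.
  exact: measurable_normal_pdf.
- move=> x _; rewrite -!EFinM lee_fin !normal_pdfE// /normal_fun !subr0 s'2.
  set u := x ^+ 2 / (4 * s ^+ 2).
  have -> : - x ^+ 2 / (s ^+ 2 *+ 2) = - u - u.
    by rewrite /u; field; exact: s0.
  have -> : - x ^+ 2 / ((2 * s ^+ 2) *+ 2) = - u.
    by rewrite /u; field; exact: s0.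
  have -> : x ^+ 2 = u * (4 * s ^+ 2).
    by rewrite /u divfK// gt_eqF// mulr_gt0.
  have -> : c * (normal_peak s' * expR (- u)) =
            normal_peak s * (4 * s ^+ 2) * expR (- u).
    by rewrite /c; field; rewrite gt_eqF.
  have uexp : u * expR (- u) <= 1.
    rewrite expRN ler_pdivrMr ?expR_gt0// mul1r.
    by rewrite (le_trans _ (expR_ge1Dx u))// lerDr.
  rewrite expRD.
  rewrite [leLHS](_ : _ = (u * expR (- u)) *
    (normal_peak s * (4 * s ^+ 2) * expR (- u))); last by ring.
  apply: ler_piMl => //; apply: mulr_ge0 (expR_ge0 _).
  by apply: mulr_ge0; [exact: ltW|apply: mulr_ge0 => //; exact: ltW].
Qed.

(** * Reflecting an independent symmetric variable *)

(** Measurable rectangles form a pi-system generating the product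
    sigma-algebra, so they determine the law of a pair. *)
Lemma eq_integral_law_prod (d d1 d2 : measure_display) (T : measurableType d)
    (T1 : measurableType d1) (T2 : measurableType d2) (R : realType)
    (P : probability T R) (X Y : {mfun T >-> (T1 * T2)%type})
    (phi : T1 * T2 -> \bar R) :
  (forall A B, measurable A -> measurable B ->
    P (X @^-1` (A `*` B)) = P (Y @^-1` (A `*` B))) ->
  measurable_fun setT phi -> (forall z, 0 <= phi z)%E ->
  (\int[P]_w phi (X w) = \int[P]_w phi (Y w))%E.
Proof.
move=> XY mphi phi0.
have := ge0_integral_distribution (P := P) X mphi phi0; rewrite /comp => <-.
have := ge0_integral_distribution (P := P) Y mphi phi0; rewrite /comp => <-.
apply: eq_measure_integral => E mE _.
apply: (measure_unique [set A `*` B | A in @measurable _ T1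
                                    & B in @measurable _ T2]
  (fun=> setT)) => //.
- exact: measurable_prod_measurableType.
- move=> _ _ [A mA [B mB <-]] [A' mA' [B' mB' <-]].
  by rewrite -setXI; exists (A `&` A'); [exact: measurableI|
    exists (B `&` B'); [exact: measurableI|]].
- by move=> _; exists setT => //; exists setT => //; rewrite setXTT.
- by rewrite bigcup_const.
- by move=> _ [A mA [B mB <-]]; exact: XY.
- by move=> _; apply: (le_lt_trans (probability_le1 _ _)) => //; rewrite ltry.
Qed.

Lemma measurable_gsigma_id (d : measure_display) (T : measurableType d)
    (G : set (set T)) : sigma_algebra [set: T] G -> G `<=` measurable ->
  measurable_fun [set: T] (id : T -> g_sigma_algebraType G).
Proof.
by move=> sG Gm _ A; rewrite measurable_g_measurableTypeE// setTI => /Gm.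
Qed.

(** A symmetric variable independent of a sigma-algebra $G$ can be reflected
    in any nonnegative functional of itself and of $G$-measurable data. The
    sample point itself, seen in the coarser measurable space of $G$, stands
    for all $G$-measurable data at once: the pairs $(w, D(w))$ and
    $(w, -D(w))$ have the same law on the product with the real line. *)
Lemma integral_indep_symmetric (d : measure_display) (T : measurableType d)
    (R : realType) (P : probability T R) (G : set (set T)) (D : T -> R)
    (phi : g_sigma_algebraType G * R -> \bar R) :
  sigma_algebra [set: T] G -> G `<=` measurable ->
  measurable_fun [set: T] D ->
  (forall U : set R, measurable U ->
    P (D @^-1` (-%R @^-1` U)) = P (D @^-1` U)) ->
  (forall (A : set T) (U : set R), G A -> measurable U ->
    P (A `&` D @^-1` U) = P A * P (D @^-1` U))%E ->
  measurable_fun setT phi -> (forall z, 0 <= phi z)%E ->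
  (\int[P]_w phi (w, (D w)) = \int[P]_w phi (w, (- D w)%R))%E.
Proof.
move=> sG Gm mD symD indD mphi phi0.
have mid := measurable_gsigma_id sG Gm.
pose S1 (w : T) : g_sigma_algebraType G * R := (w, D w).
pose S2 (w : T) : g_sigma_algebraType G * R := (w, - D w).
have mS1 : measurable_fun setT S1 by exact: measurable_fun_pair.
have mS2 : measurable_fun setT S2.
  by apply: measurable_fun_pair => //; exact: measurableT_comp.
pose X1 : {mfun T >-> _} := HB.pack S1 (isMeasurableFun.Build _ _ _ _ S1 mS1).
pose X2 : {mfun T >-> _} := HB.pack S2 (isMeasurableFun.Build _ _ _ _ S2 mS2).
apply: (@eq_integral_law_prod _ _ _ _ _ _ _ P X1 X2) => // A B.
rewrite measurable_g_measurableTypeE// => GA mB.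
transitivity (P (A `&` D @^-1` B)); first by [].
transitivity (P (A `&` D @^-1` (-%R @^-1` B))); last by [].
rewrite !indD// ?symD// -[_ @^-1` _]setTI.
exact: oppr_measurable.
Qed.

(** * The Euclidean norm; continuity and measurability *)

(** An open set of row vectors is a countable union of boxes with rational
    centre and rational half-width, and the preimage of a box only involves
    the coordinates. *)
Lemma measurable_continuous_rV (d : measure_display) (T : measurableType d)
    (R : realType) (n : nat) (h : 'rV[R]_n -> R) (Y : T -> 'rV[R]_n) :
  continuous h -> (forall i, measurable_fun setT (fun w => Y w 0 i)) ->
  measurable_fun setT (fun w => h (Y w)).
Proof.
move=> ch mY; apply: (measurability _ (RGenOpens.measurableE R)).
move=> _ [U [a [b UE]] <-]; rewrite setTI.
have oU : open U by rewrite UE; exact: interval_open.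
have oV : open (h @^-1` U) by move/continuousP : ch; exact.
pose box (p : 'rV[rat]_n * rat) : set 'rV[R]_n :=
  [set y | forall i, `|y 0 i - ratr (p.1 0 i)| < ratr p.2].
pose I : set ('rV[rat]_n * rat) := [set p | box p `<=` h @^-1` U].
have -> : (fun w => h (Y w)) @^-1` U = \bigcup_(p in I) (Y @^-1` box p).
  apply/seteqP; split => [w /= hUw|w [p /= Ip]]; last exact: Ip.
  have /nbhs_ballP[e /= e0 eV] : nbhs (Y w) (h @^-1` U).
    exact: open_nbhs_nbhs.
  (* Half of the radius: the box is centred near Y w and not at Y w. *)
  have e20 : 0 < e / 2 by rewrite divr_gt0.
  have [r] := rat_in_itvoo e20; rewrite in_itv/= => /andP[r0 re].
  have /choice[v vP] : forall i, exists q : rat, `|Y w 0 i - ratr q| < ratr r.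
    move=> i; have Yr : Y w 0 i - ratr r < Y w 0 i + ratr r by lra.
    have [q] := rat_in_itvoo Yr.
    by rewrite in_itv/= => ?; exists q; rewrite ltr_distlC; lra.
  exists (\row_i v i, r); last by move=> i /=; rewrite mxE.
  move=> y /= boxy; apply: eV; split => // i j; rewrite ord1 /ball/= /ball_.
  have := boxy j; have := vP j; rewrite /= mxE distrC.
  rewrite !ltr_norml; lra.
rewrite bigcup_mkcond; apply: countable_bigcupT_measurable => // -[v r].
case: ifPn => // _.
have -> : Y @^-1` box (v, r) =
    \bigcap_(i in [set: 'I_n]) ((fun w => Y w 0 i) @^-1`
      ball (ratr (v 0 i) : R) (ratr r)).
  apply/seteqP; split => w /= boxw i; last by rewrite distrC; exact: boxw.
  by move=> _; rewrite /ball/= distrC; exact: boxw.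
apply: fin_bigcap_measurable => // i _.
have mB : measurable (ball (ratr (v 0 i) : R) (ratr r)).
  by apply: open_measurable; exact: ball_open.
by have := mY i measurableT _ mB; rewrite setTI.
Qed.

Lemma dotp_ge0 (R : realType) (n : nat) (x : 'rV[R]_n) : 0 <= dotp x x.
Proof. by apply: sumr_ge0 => i _; rewrite -expr2 sqr_ge0. Qed.

Lemma dotpNN (R : realType) (n : nat) (x y : 'rV[R]_n) :
  dotp (- x) (- y) = dotp x y.
Proof. by apply: eq_bigr => i _; rewrite !mxE mulrNN. Qed.

Lemma enorm_sqr (R : realType) (n : nat) (x : 'rV[R]_n) :
  enorm x ^+ 2 = dotp x x.
Proof. by rewrite sqr_sqrtr// dotp_ge0. Qed.

Lemma sqr_coord_le (R : realType) (n : nat) (x : 'rV[R]_n) (i : 'I_n) :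
  x 0 i ^+ 2 <= enorm x ^+ 2.
Proof.
rewrite enorm_sqr /dotp (bigD1 i)//= -expr2 lerDl.
by apply: sumr_ge0 => j _; rewrite -expr2 sqr_ge0.
Qed.

Lemma dotp_continuous (R : realType) (n : nat) (x : 'rV[R]_n) :
  continuous (fun y : 'rV[R]_n => dotp (x - y) (x - y)).
Proof.
have -> : (fun y : 'rV[R]_n => dotp (x - y) (x - y)) =
    (fun y => \sum_(i < n) (x 0 i - y 0 i) * (x 0 i - y 0 i)).
  by apply/funext => y; apply: eq_bigr => i _; rewrite !mxE.
apply: continuous_big => [|i _ y]; first exact: add_continuous.
have cc : {for y, continuous (fun z : 'rV[R]_n => x 0 i - z 0 i)}.
  by apply: (@cvgB _ _ _ (nbhs y)); [exact: cvg_cst|exact: coord_continuous].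
exact: (cvgM cc cc).
Qed.

(** Continuity at $x$ is tested on the ball whose radius is an integer above
    $|x| + 1$, which contains a neighbourhood of $x$. *)
Lemma continuous_of_local_lipschitz (R : realType) (n : nat)
    (h : 'rV[R]_n -> 'rV[R]_n) (i : 'I_n) :
  (forall r : nat, (1 <= r)%N -> exists2 K : R, 0 < K &
    forall x y, enorm x <= r%:R -> enorm y <= r%:R ->
      enorm (h x - h y) ^+ 2 <= K * enorm (x - y) ^+ 2) ->
  continuous (fun x => h x 0 i).
Proof.
move=> lip x.
pose r := (Num.bound (enorm x + 1)).+1.
have xr : enorm x + 1 < r%:R.
  rewrite (lt_le_trans (archi_boundP _)) ?ler_nat//.
  by rewrite addr_ge0 ?sqrtr_ge0.
have [//|K K0 hK] := lip r.
apply/(@cvgrPdist_lt _ _ _ (nbhs x)) => e e0.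
have near_lt (z : 'rV[R]_n) (c : R) : dotp (z - x) (z - x) < c ->
    \forall y \near x, dotp (z - y) (z - y) < c.
  by move=> zc; exact: (cvgr_lt _ (@dotp_continuous R n z x)) zc.
have dK : 0 < e ^+ 2 / K by rewrite divr_gt0// exprn_gt0.
have n1 : \forall y \near x, dotp (x - y) (x - y) < e ^+ 2 / K.
  by apply: near_lt; rewrite subrr /dotp big1// => j _; rewrite mxE mulr0.
have n2 : \forall y \near x, dotp (0 - y) (0 - y) < r%:R ^+ 2.
  apply: near_lt; rewrite !sub0r dotpNN -enorm_sqr.
  by rewrite ltr_sqr ?nnegrE ?sqrtr_ge0//; lra.
near=> y.
have yr : enorm y <= r%:R.
  rewrite -ler_sqr ?nnegrE ?sqrtr_ge0// enorm_sqr ltW//.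
  by rewrite -dotpNN -sub0r; near: y.
rewrite -ltr_sqr ?nnegrE ?(ltW e0)// real_normK ?num_real//.
have -> : h x 0 i - h y 0 i = (h x - h y) 0 i by rewrite !mxE.
apply: le_lt_trans (sqr_coord_le _ _) _; apply: le_lt_trans (hK _ _ _ yr) _.
  by lra.
rewrite mulrC -ltr_pdivlMr// enorm_sqr; near: y; exact: n1.
Unshelve. all: by end_near. Qed.

Lemma local_lipschitz_continuous (R : realType) (n : nat)
    (f g : 'rV[R]_n -> R -> 'rV[R]_n) (t : R) (i : 'I_n) :
  local_lipschitz f g -> 0 <= t ->
  continuous (fun x => f x t 0 i) /\ continuous (fun x => g x t 0 i).
Proof.
move=> lip t0; split; apply: continuous_of_local_lipschitz => r r1;
  have [K K0 KP] := lip r t r1 t0; exists K => // x y xr yr;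
  by apply: le_trans (KP x y _); rewrite ?le_max ?lexx ?orbT// ge_max xr.
Qed.

(** * Adaptedness and the mean square of one step *)

Lemma measurable_fun_gsigmaS (T : pointedType) (G H : set (set T))
    (R : realType) (X : T -> R) :
  sigma_algebra [set: T] G -> sigma_algebra [set: T] H -> G `<=` H ->
  measurable_fun setT (X : g_sigma_algebraType G -> R) ->
  measurable_fun setT (X : g_sigma_algebraType H -> R).
Proof.
move=> sG sH GH mX _ A mA; have := mX measurableT A mA.
by rewrite !measurable_g_measurableTypeE// => /GH.
Qed.

Lemma measurable_fun_of_gsigma (d : measure_display) (T : measurableType d)
    (G : set (set T)) (R : realType) (X : T -> R) :
  sigma_algebra [set: T] G -> G `<=` measurable ->
  measurable_fun setT (X : g_sigma_algebraType G -> R) ->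
  measurable_fun [set: T] X.
Proof.
move=> sG Gm mX _ A mA; have := mX measurableT A mA.
by rewrite measurable_g_measurableTypeE// => /Gm.
Qed.

Lemma measurable_enorm_sqr (d : measure_display) (T : measurableType d)
    (R : realType) (n : nat) (a : T -> 'rV[R]_n) :
  (forall i, measurable_fun setT (fun w => a w 0 i)) ->
  measurable_fun setT (fun w => (enorm (a w) ^+ 2)%:E).
Proof.
move=> ma; under eq_fun do rewrite enorm_sqr.
by apply/measurable_EFinP; apply: measurable_sum => i; exact: measurable_funM.
Qed.

(** Continuity in space, for each fixed time, is what makes the coefficients
    evaluated along the scheme measurable for the current sigma-algebra. *)
Lemma euler_maruyama_adapted (d : measure_display) (T : measurableType d)
    (R : realType) (P : probability T R) (F : R -> set (set T))
    (B : R -> T -> R) (n : nat) (f g : 'rV[R]_n -> R -> 'rV[R]_n) (dt : R)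
    (y0 : 'rV[R]_n) (k : nat) (i : 'I_n) :
  usual_filtration P F -> brownian_motion P F B -> 0 <= dt ->
  local_lipschitz f g ->
  measurable_fun setT ((fun w => euler_maruyama f g B dt y0 k w 0 i) :
    g_sigma_algebraType (F (k%:R * dt)) -> R).
Proof.
move=> uF bB dt0 lip; elim: k i => [|k IHk] i /=; first exact: measurable_cst.
have t0 j : 0 <= j%:R * dt by rewrite mulr_ge0.
have kS : k%:R * dt <= k.+1%:R * dt by rewrite ler_wpM2r// ler_nat.
have sF j : sigma_algebra [set: T] (F (j%:R * dt)).
  exact: filtration_sigma_algebra uF _ (t0 j).
have lift X :
    measurable_fun setT (X : g_sigma_algebraType (F (k%:R * dt)) -> R) ->
    measurable_fun setT (X : g_sigma_algebraType (F (k.+1%:R * dt)) -> R).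
  apply: measurable_fun_gsigmaS => //.
  exact: filtration_nondecreasing uF _ _ _ _.
have mB j : measurable_fun setT (B (j%:R * dt) :
    g_sigma_algebraType (F (j%:R * dt)) -> R).
  move=> _ A mA; rewrite setTI measurable_g_measurableTypeE//.
  exact: brownian_adapted bB _ _ (t0 j) mA.
under eq_fun do rewrite !mxE.
apply: measurable_funD; last apply: measurable_funM.
- apply: lift; apply: measurable_funD => //; apply: measurable_funM => //.
  exact: (measurable_continuous_rV
    (local_lipschitz_continuous i lip (t0 k)).1 IHk).
- by apply: measurable_funB; [exact: mB|exact: lift].
- apply: lift; exact: (measurable_continuous_rV
    (local_lipschitz_continuous i lip (t0 k)).2 IHk).
Qed.

Lemma parallelogram_enorm (R : realType) (n : nat) (a b : 'rV[R]_n) (x : R) :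
  enorm (a + x *: b) ^+ 2 + enorm (a + (- x) *: b) ^+ 2 =
  2 * (enorm a ^+ 2 + x ^+ 2 * enorm b ^+ 2).
Proof.
rewrite !enorm_sqr /dotp mulr_sumr -!big_split/= mulr_sumr.
by apply: eq_bigr => i _; rewrite !mxE; ring.
Qed.

(** The cross term of the square vanishes in mean because reflecting $D$ does
    not change the expectation; adding both versions and using the
    parallelogram identity removes that term pointwise. The comparison is
    made after doubling, which is harmless in the extended reals even if the
    integrals are infinite. *)
Lemma expectation_sqr_indep_le (d : measure_display) (T : measurableType d)
    (R : realType) (P : probability T R) (G : set (set T)) (D : T -> R)
    (n : nat) (a b : T -> 'rV[R]_n) (c : R) :
  sigma_algebra [set: T] G -> G `<=` measurable ->
  measurable_fun [set: T] D ->
  (forall U : set R, measurable U ->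
    P (D @^-1` (-%R @^-1` U)) = P (D @^-1` U)) ->
  (forall (A : set T) (U : set R), G A -> measurable U ->
    P (A `&` D @^-1` U) = P A * P (D @^-1` U))%E ->
  (forall i, measurable_fun setT
    ((fun w => a w 0 i) : g_sigma_algebraType G -> R)) ->
  (forall i, measurable_fun setT
    ((fun w => b w 0 i) : g_sigma_algebraType G -> R)) ->
  (forall w, enorm (b w) ^+ 2 <= c) ->
  (\int[P]_w (enorm (a w + D w *: b w) ^+ 2)%:E <=
   \int[P]_w (enorm (a w) ^+ 2)%:E + c%:E * \int[P]_w (D w ^+ 2)%:E)%E.
Proof.
move=> sG Gm mD symD indD ma mb bc.
pose phi (z : g_sigma_algebraType G * R) : \bar R :=
  (enorm (a z.1 + z.2 *: b z.1) ^+ 2)%:E.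
have mphi : measurable_fun setT phi.
  apply: measurable_enorm_sqr => i; under eq_fun do rewrite !mxE.
  apply: measurable_funD.
    by apply: (measurableT_comp (ma i)); exact: measurable_fst.
  apply: measurable_funM; first exact: measurable_snd.
  by apply: (measurableT_comp (mb i)); exact: measurable_fst.
have phi0 z : (0 <= phi z)%E by rewrite lee_fin sqr_ge0.
have symI := integral_indep_symmetric sG Gm mD symD indD mphi phi0.
have mid := measurable_gsigma_id sG Gm.
have mphiD (E : T -> R) : measurable_fun setT E ->
    measurable_fun setT (fun w : T => phi (w, E w)).
  by move=> mE; exact: (measurableT_comp mphi (measurable_fun_pair mid mE)).
have ma2 : measurable_fun [set: T] (fun w => (enorm (a w) ^+ 2)%:E).
  by apply: measurable_enorm_sqr => i; exact: (measurable_fun_of_gsigma sG Gm).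
have mD2 : measurable_fun [set: T] (fun w => (D w ^+ 2)%:E).
  by apply/measurable_EFinP; exact: measurable_funX.
rewrite -(@lee_pmul2l _ 2%:E)//.
have -> : (2%:E * \int[P]_w (enorm (a w + D w *: b w) ^+ 2)%:E =
    \int[P]_w (phi (w, D w) + phi (w, (- D w)%R)))%E.
  rewrite ge0_integralD//.
  - by rewrite -symI mule_natl mule2n.
  - exact: mphiD.
  - by apply: mphiD; exact: measurableT_comp.
have c0 : 0 <= c by exact: le_trans (sqr_ge0 _) (bc point).
have cD0 w : (0 <= c%:E * (D w ^+ 2)%:E)%E.
  by rewrite mule_ge0// lee_fin sqr_ge0.
have mcD : measurable_fun [set: T] (fun w => c%:E * (D w ^+ 2)%:E)%E.
  exact: emeasurable_funM.
have a0 w : (0 <= (enorm (a w) ^+ 2)%:E)%E by rewrite lee_fin sqr_ge0.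
have mI : measurable_fun [set: T]
    (fun w => (enorm (a w) ^+ 2)%:E + c%:E * (D w ^+ 2)%:E)%E.
  exact: emeasurable_funD.
apply: (@le_trans _ _ (\int[P]_w (2%:E * ((enorm (a w) ^+ 2)%:E +
    c%:E * (D w ^+ 2)%:E)))%E).
  apply: ge0_le_integral => //.
  - by move=> w _; rewrite adde_ge0.
  - apply: emeasurable_funD; apply: mphiD => //; exact: measurableT_comp.
  - exact: emeasurable_funM.
  - move=> w _; rewrite /phi /= -?(EFinM, EFinD) lee_fin parallelogram_enorm.
    by rewrite ler_pM2l// lerD2l mulrC ler_wpM2r ?sqr_ge0.
rewrite ge0_integralZl//; last by move=> w _; rewrite adde_ge0.
rewrite ge0_integralD// ge0_integralZl//.
by move=> w _; rewrite lee_fin sqr_ge0.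
Qed.

(** * Brownian increments *)

Lemma brownian_measurable (d : measure_display) (T : measurableType d)
    (R : realType) (P : probability T R) (F : R -> set (set T))
    (B : R -> T -> R) (t : R) :
  usual_filtration P F -> brownian_motion P F B -> 0 <= t ->
  measurable_fun [set: T] (B t).
Proof.
move=> uF bB t0 _ A mA; rewrite setTI.
by apply: (filtration_measurable uF t0); exact: brownian_adapted bB _ _ t0 mA.
Qed.

Lemma brownian_increment_symmetric (d : measure_display) (T : measurableType d)
    (R : realType) (P : probability T R) (F : R -> set (set T))
    (B : R -> T -> R) (s t : R) (U : set R) :
  brownian_motion P F B -> 0 <= s -> s < t -> measurable U ->
  P ((fun w => B t w - B s w) @^-1` (-%R @^-1` U)) =
  P ((fun w => B t w - B s w) @^-1` U).
Proof.
move=> bB s0 st mU.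
have mNU : measurable (-%R @^-1` U : set R).
  by rewrite -[_ @^-1` _]setTI; exact: oppr_measurable.
rewrite !(brownian_increment_normal bB s0 st)//; apply: normal_prob_opp => //.
by rewrite gt_eqF// sqrtr_gt0 subr_gt0.
Qed.

Lemma brownian_increment_moment2 (d : measure_display) (T : measurableType d)
    (R : realType) (P : probability T R) (F : R -> set (set T))
    (B : R -> T -> R) (s t : R) :
  usual_filtration P F -> brownian_motion P F B -> 0 <= s -> s < t ->
  (\int[P]_w ((B t w - B s w) ^+ 2)%:E =
   \int[normal_prob 0 (Num.sqrt (t - s))]_x (x ^+ 2)%:E)%E.
Proof.
move=> uF bB s0 st; pose D w := B t w - B s w.
have t0 : 0 <= t by rewrite (le_trans s0)// ltW.
have mD : measurable_fun [set: T] D.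
  by apply: measurable_funB; exact: (brownian_measurable uF bB).
have m2 : measurable_fun [set: R] (fun x : R => (x ^+ 2)%:E).
  by apply/measurable_EFinP; exact: measurable_funX.
(* The normal law lives on the measurable type generated by the half-open
   intervals, a different display from the default one of the real line. *)
pose D' : T -> measurableTypeR R := D.
have mD' : measurable_fun [set: T] D' by exact: mD.
pose X : {mfun T >-> measurableTypeR R} :=
  HB.pack D' (isMeasurableFun.Build _ _ _ _ D' mD').
have := ge0_integral_distribution (P := P) X m2; rewrite /comp => <-;
  last by move=> x; rewrite lee_fin sqr_ge0.
apply: (@eq_measure_integral _ (measurableTypeR R)) => A mA _.
exact: brownian_increment_normal bB _ _ _ s0 st mA.
Qed.

(** * Real recursions and logarithmic limsup *)

(** A Bernoulli inequality: $(1+s)^{-K} = e^{-K\ln(1+s)} \ge 1 - K\ln(1+s)$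
    and $\ln(1+s) \le s$. *)
Lemma one_sub_le_powR (R : realType) (K s : R) : 0 <= K -> 0 <= s ->
  1 - K * s <= (1 + s) `^ (- K).
Proof.
move=> K0 s0; have s1 : 1 + s != 0 by rewrite gt_eqF// ltr_wpDr.
rewrite /powR (negbTE s1) mulNr; apply: le_trans (expR_ge1Dx _).
by rewrite lerD2l lerN2 ler_wpM2l// le_ln1Dx// (lt_le_trans _ s0).
Qed.

Lemma sqr_powRN (R : realType) (x K : R) :
  (x `^ (- K)) ^+ 2 = x `^ (- (2 * K)).
Proof. by rewrite -powR_mulrn ?powR_ge0// -powRrM mulNr mulrC. Qed.

(** One step of the drift shrinks $t^{-2K}$ at least to its value at the next
    time, because $t + \Delta t = (1 + \Delta t/t)\,t$. *)
Lemma contraction_powR (R : realType) (K dt t : R) :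
  0 <= K -> 0 < dt -> K * dt <= 1 -> 1 <= t ->
  (1 - K * (dt / t)) ^+ 2 * t `^ (- (2 * K)) <= (t + dt) `^ (- (2 * K)).
Proof.
move=> K0 dt0 Kdt t1; have t0 : 0 < t by lra.
have s0 : 0 <= dt / t by rewrite divr_ge0// ltW.
have Ks : K * (dt / t) <= 1.
  by rewrite mulrA ler_pdivrMr// mul1r (le_trans Kdt).
rewrite -!sqr_powRN -exprMn ler_sqr ?nnegrE ?mulr_ge0 ?powR_ge0 ?subr_ge0//.
have -> : t + dt = (1 + dt / t) * t by field; rewrite gt_eqF.
rewrite powRM ?(ltW t0) ?addr_ge0// ler_wpM2r ?powR_ge0//.
exact: one_sub_le_powR.
Qed.

(** For $t \ge 1$ one has $t + \Delta t \le (1 + \Delta t)\,t$, so moving to the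
    next time costs a bounded factor. *)
Lemma powR_shift_le (R : realType) (p dt t : R) :
  0 <= p -> 0 < dt -> 1 <= t ->
  t `^ (- p) <= (1 + dt) `^ p * (t + dt) `^ (- p).
Proof.
move=> p0 dt0 t1.
have [t0 td0] : 0 < t /\ 0 < t + dt by split; lra.
rewrite !powRN ler_pdivlMr ?powR_gt0// mulrC ler_pdivrMr ?powR_gt0//.
rewrite -powRM; [|lra..].
by rewrite ge0_ler_powR ?nnegrE //; [lra| |]; nra.
Qed.

(** For large $k$ the logarithm of the bound is at most
    $\ln M - p \ln(k\Delta t)$, and $\ln M$ is negligible in front of
    $\ln(k\Delta t)$. The values of the sequence may vanish, in which case
    the ratio is $-\infty$. *)
Lemma limn_esup_ln_ratio_le (R : realType) (e : nat -> \bar R) (M p dt : R) :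
  0 < M -> 0 <= p -> 0 < dt ->
  (forall k, (0 < k)%N -> (e k <= (M * (1 + k%:R * dt) `^ (- p))%:E)%E) ->
  (limn_esup (fun k : nat => lne (e k) / lne (k%:R * dt)%:E) <= (- p)%:E)%E.
Proof.
move=> M0 p0 dt0 eM; apply/lee_addgt0Pr => eps eps0.
(* Beyond L0 one has ln M <= eps * ln (k dt), and ln (k dt) > 0. *)
pose L0 := 1 + `|ln M| / eps.
pose N := (Num.bound (expR L0 / dt)).+1.
rewrite /limn_esup /limf_esup; apply: ge_ereal_inf.
exists (ereal_sup [set lne (e k) / lne (k%:R * dt)%:E |
    k in [set k | N <= k]%N])%E.
  by exists [set k | N <= k]%N => //; exists N.
apply: ge_ereal_sup => _ [k /= Nk <-].
have k0 : (0 < k)%N by exact: leq_trans Nk.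
have L0pos : 0 <= L0 by rewrite addr_ge0// divr_ge0// ltW.
have kdt : expR L0 < k%:R * dt.
  rewrite -ltr_pdivrMr// (lt_le_trans (archi_boundP _))//.
    by rewrite divr_ge0 ?expR_ge0// ltW.
  by rewrite ler_nat (leq_trans _ Nk).
have kdt0 : 0 < k%:R * dt by rewrite (lt_trans _ kdt) ?expR_gt0.
pose L := ln (k%:R * dt).
have L0L : L0 < L by rewrite /L -(expRK L0) ltr_ln// posrE expR_gt0.
have Lpos : 0 < L by exact: le_lt_trans L0L.
rewrite [X in (_ / X)%E]lne_EFin// -/L inver gt_eqF//.
have [ek0|ek0] := leP (e k) 0%E.
  by rewrite le0_lneNy// gt0_mulNye ?leNye// lte_fin invr_gt0.
have := eM k k0; case: (e k) ek0 => [r| |]//; rewrite lte_fin lee_fin => r0 rM.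
rewrite lne_EFin// -EFinM -EFinD lee_fin ler_pdivrMr//.
have t0 : 0 < 1 + k%:R * dt by rewrite addr_gt0.
have : ln r <= ln M - p * ln (1 + k%:R * dt).
  rewrite -mulNr -ln_powR -lnM ?posrE ?powR_gt0//.
  by rewrite ler_ln ?posrE// mulr_gt0// powR_gt0.
have : L <= ln (1 + k%:R * dt) by rewrite ler_ln ?posrE// lerDr.
have : ln M <= eps * L.
  apply: le_trans (ler_norm _) _; rewrite mulrC -ler_pdivrMr//.
  by apply: le_trans (ltW L0L); rewrite /L0 lerDr.
move=> h1 h2 h3; apply: (le_trans h3).
have : p * L <= p * ln (1 + k%:R * dt) by rewrite ler_wpM2l.
lra.
Qed.

(** Multiplied by $(1 + k\Delta t)^{2K}$, the sequence increases by at most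
    $c(1 + \Delta t)^{2K}$ at each step: the contraction factor is absorbed
    by the change of weight. *)
Lemma linear_growth_powR_bound (R : realType) (e : nat -> \bar R)
    (K c dt A : R) :
  0 <= K -> 0 <= c -> 0 < dt -> K * dt <= 1 -> 0 <= A -> (e 1%N <= A%:E)%E ->
  (forall k, (0 < k)%N -> (e k.+1 <=
    ((1 - K * (dt / (1 + k%:R * dt))) ^+ 2)%:E * e k +
    (c * (1 + k%:R * dt) `^ (- (2 * K)))%:E)%E) ->
  forall k, (0 < k)%N -> (e k <=
    ((A * (1 + dt) `^ (2 * K) + c * (1 + dt) `^ (2 * K) * k%:R) *
      (1 + k%:R * dt) `^ (- (2 * K)))%:E)%E.
Proof.
move=> K0 c0 dt0 Kdt A0 e1 eS; set q := (1 + dt) `^ (2 * K).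
have q0 : 0 <= q by exact: powR_ge0.
have K20 : 0 <= 2 * K by rewrite mulr_ge0.
elim=> // -[_ _|k IHk _].
  apply: le_trans e1 _; rewrite lee_fin mul1r mulrDl.
  rewrite -mulrA /q powRN divff ?mulr1 ?gt_eqF ?powR_gt0 ?addr_gt0//.
  by rewrite lerDl !mulr_ge0 ?powR_ge0 ?invr_ge0.
apply: le_trans (eS _ _) _ => //; set t := 1 + k.+1%:R * dt.
have t1 : 1 <= t by rewrite lerDl mulr_ge0// ltW.
have -> : 1 + k.+2%:R * dt = t + dt by rewrite /t -[k.+2]addn1 natrD; ring.
have := contraction_powR K0 dt0 Kdt t1.
have := powR_shift_le K20 dt0 t1; rewrite -/q.
have := IHk isT; rewrite -/t.
set z := t `^ _; set z' := (t + dt) `^ _; set r := (1 - _) ^+ 2.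
set a := A * q + _ => ek zz' rz.
have a0 : 0 <= a by rewrite addr_ge0 ?mulr_ge0.
apply: (@le_trans _ _ (r%:E * (a * z)%:E + (c * z)%:E)%E).
  by rewrite leeD2r// lee_wpmul2l// lee_fin sqr_ge0.
rewrite -EFinM -EFinD lee_fin.
have -> : A * q + c * q * k.+2%:R = a + c * q.
  by rewrite /a -[k.+2]addn1 natrD; ring.
have -> : r * (a * z) = a * (r * z) by ring.
have -> : (a + c * q) * z' = a * z' + c * (q * z') by ring.
by rewrite lerD// ler_wpM2l.
Qed.

(** * The mean-square recursion of the scheme *)

(** Expanding the square, the inward drift contributes $-2q\,dt$ and the
    linear growth bound $q^2 dt^2$, which complete to a perfect square. *)
Lemma sqr_enorm_drift_le (R : realType) (n : nat) (x y : 'rV[R]_n) (q dt : R) :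
  0 <= q -> 0 <= dt -> enorm y <= q * enorm x ->
  dotp x y <= - q * enorm x ^+ 2 ->
  enorm (x + dt *: y) ^+ 2 <= (1 - q * dt) ^+ 2 * enorm x ^+ 2.
Proof.
move=> q0 dt0 yx xy.
have -> : enorm (x + dt *: y) ^+ 2 =
    enorm x ^+ 2 + 2 * dt * dotp x y + dt ^+ 2 * enorm y ^+ 2.
  rewrite !enorm_sqr /dotp !mulr_sumr -!big_split/=; apply: eq_bigr => i _.
  by rewrite !mxE; ring.
have y2 : enorm y ^+ 2 <= q ^+ 2 * enorm x ^+ 2.
  by rewrite -exprMn ler_sqr ?nnegrE ?mulr_ge0 ?sqrtr_ge0.
have : dt ^+ 2 * enorm y ^+ 2 <= dt ^+ 2 * (q ^+ 2 * enorm x ^+ 2).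
  by rewrite ler_wpM2l// sqr_ge0.
have : dt * dotp x y <= dt * (- q * enorm x ^+ 2) by rewrite ler_wpM2l.
move=> h1 h2.
have -> : (1 - q * dt) ^+ 2 * enorm x ^+ 2 = enorm x ^+ 2 +
   2 * (dt * (- q * enorm x ^+ 2)) + dt ^+ 2 * (q ^+ 2 * enorm x ^+ 2) by ring.
by rewrite -mulrA; lra.
Qed.

(** The bound on the noise coefficient is only asked along the scheme, so
    that the lemma also applies at time $0$, where the scheme is
    deterministic and the coefficient may be unbounded in space. *)
Lemma euler_maruyama_step (d : measure_display) (T : measurableType d)
    (R : realType) (P : probability T R) (F : R -> set (set T))
    (B : R -> T -> R) (n : nat) (f g : 'rV[R]_n -> R -> 'rV[R]_n) (dt : R)
    (y0 : 'rV[R]_n) (k : nat) (c : R) :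
  usual_filtration P F -> brownian_motion P F B -> 0 < dt ->
  local_lipschitz f g ->
  let Y := euler_maruyama f g B dt y0 in
  (forall w, enorm (g (Y k w) (k%:R * dt)) ^+ 2 <= c) ->
  (\int[P]_w (enorm (Y k.+1 w) ^+ 2)%:E <=
   \int[P]_w (enorm (Y k w + dt *: f (Y k w) (k%:R * dt)) ^+ 2)%:E +
   c%:E * \int[normal_prob 0 (Num.sqrt dt)]_x (x ^+ 2)%:E)%E.
Proof.
move=> uF bB dt0 lip Y gc; rewrite /Y.
have t0 : 0 <= k%:R * dt by rewrite mulr_ge0// ltW.
have tS : k%:R * dt < k.+1%:R * dt by rewrite ltr_pM2r// ltr_nat.
have -> : Num.sqrt dt = Num.sqrt (k.+1%:R * dt - k%:R * dt).
  by congr Num.sqrt; rewrite -natr1; ring.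
rewrite -(brownian_increment_moment2 uF bB t0 tS).
have mY i :=
  @euler_maruyama_adapted _ _ _ _ _ _ _ _ _ _ y0 k i uF bB (ltW dt0) lip.
apply: (expectation_sqr_indep_le
  (filtration_sigma_algebra uF t0) (filtration_measurable uF t0)).
- by apply: measurable_funB; apply: (brownian_measurable uF bB) => //;
    rewrite (le_trans t0)// ltW.
- by move=> U; exact: brownian_increment_symmetric bB t0 tS.
- by move=> A U; exact: brownian_increment_independent bB _ _ _ _ t0 tS.
- move=> i; under eq_fun do rewrite !mxE.
  apply: measurable_funD => //; apply: measurable_funM => //.
  exact: (measurable_continuous_rV (local_lipschitz_continuous i lip t0).1 mY).
- move=> i.
  exact: (measurable_continuous_rV (local_lipschitz_continuous i lip t0).2 mY).
- by move=> w; exact: gc.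
Qed.

Lemma euler_maruyama_contraction (d : measure_display) (T : measurableType d)
    (R : realType) (P : probability T R) (F : R -> set (set T))
    (B : R -> T -> R) (n : nat) (f g : 'rV[R]_n -> R -> 'rV[R]_n) (dt : R)
    (y0 : 'rV[R]_n) (k : nat) (q : R) :
  usual_filtration P F -> brownian_motion P F B -> 0 < dt ->
  local_lipschitz f g -> 0 <= q ->
  (forall x, enorm (x + dt *: f x (k%:R * dt)) ^+ 2 <= q * enorm x ^+ 2) ->
  let Y := euler_maruyama f g B dt y0 in
  (\int[P]_w (enorm (Y k w + dt *: f (Y k w) (k%:R * dt)) ^+ 2)%:E <=
   q%:E * \int[P]_w (enorm (Y k w) ^+ 2)%:E)%E.
Proof.
move=> uF bB dt0 lip q0 fq; rewrite /=.
have t0 : 0 <= k%:R * dt by rewrite mulr_ge0// ltW.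
have mY i : measurable_fun [set: T]
    (fun w => euler_maruyama f g B dt y0 k w 0 i).
  apply: (measurable_fun_of_gsigma (filtration_sigma_algebra uF t0)
    (filtration_measurable uF t0)).
  exact: euler_maruyama_adapted uF bB (ltW dt0) lip.
have mY2 := measurable_enorm_sqr mY.
rewrite -ge0_integralZl//; last by move=> w _; rewrite lee_fin sqr_ge0.
apply: ge0_le_integral => //.
- by move=> w _; rewrite lee_fin sqr_ge0.
- apply: measurable_enorm_sqr => i; under eq_fun do rewrite !mxE.
  apply: measurable_funD => //; apply: measurable_funM => //.
  exact: (measurable_continuous_rV (local_lipschitz_continuous i lip t0).1 mY).
- exact: emeasurable_funM.
- by move=> w _; rewrite -EFinM lee_fin.
Qed.

Theorem theorem3p1 (R : realType) (d : measure_display) (T : measurableType d)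
    (P : probability T R) (F : R -> set (set T)) (B : R -> T -> R)
    (n : nat) (f g : 'rV[R]_n -> R -> 'rV[R]_n) (K1 C dt : R)
    (y0 : 'rV[R]_n) :
  measure_is_complete P ->
  usual_filtration P F ->
  brownian_motion P F B ->
  local_lipschitz f g ->
  0 < K1 -> 0 < C ->
  (forall (t : R) (x : 'rV[R]_n), 0 < t ->
     [/\ enorm (f x t) <= K1 * (1 + t)^-1 * enorm x,
         dotp x (f x t) <= - K1 * (1 + t)^-1 * enorm x ^+ 2 &
         enorm (g x t) <= C * (1 + t) `^ (- K1)]) ->
  1 <= K1 ->
  0 < dt -> dt < (2 + K1)^-1 ->
  (limn_esup (fun k : nat =>
     lne 'E_P[fun w => (enorm (euler_maruyama f g B dt y0 k w) ^+ 2)%R]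
       / lne (k%:R * dt)%:E)
   <= (- (2 * K1 - 1))%:E)%E.
Proof.
move=> _ uF bB lip K10 C0 fg K11 dt0 dtK.
have K1dt : K1 * dt <= 1.
  have : dt * (2 + K1) < 1 by rewrite -ltr_pdivlMr ?div1r//; lra.
  by nra.
pose e k : \bar R :=
  (\int[P]_w (enorm (euler_maruyama f g B dt y0 k w) ^+ 2)%:E)%E.
have [M mE] : exists M : R,
    (\int[normal_prob 0 (Num.sqrt dt)]_x (x ^+ 2)%:E)%E = M%:E.
  have s0 : Num.sqrt dt != 0 by rewrite gt_eqF// sqrtr_gt0.
  exists (fine (\int[normal_prob 0 (Num.sqrt dt)]_x (x ^+ 2)%:E)%E).
  rewrite fineK// ge0_fin_numE ?normal_prob_moment2_lty//.
  by apply: integral_ge0 => x _; rewrite lee_fin sqr_ge0.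
have M0 : 0 <= M.
  by rewrite -lee_fin -mE; apply: integral_ge0 => x _; rewrite lee_fin sqr_ge0.
have step k c :
    (forall w, enorm (g (euler_maruyama f g B dt y0 k w) (k%:R * dt)) ^+ 2
      <= c) ->
    (e k.+1 <= \int[P]_w (enorm (euler_maruyama f g B dt y0 k w +
      dt *: f (euler_maruyama f g B dt y0 k w) (k%:R * dt)) ^+ 2)%:E +
      (c * M)%:E)%E.
  by rewrite EFinM -mE; exact: (euler_maruyama_step uF bB dt0 lip).
have e1 : (e 1%N <= (enorm (y0 + dt *: f y0 (0%:R * dt)) ^+ 2 +
    enorm (g y0 (0%:R * dt)) ^+ 2 * M)%:E)%E.
  rewrite EFinD; set a := (enorm _ ^+ 2)%:E.
  have <- : (\int[P]_w cst a w)%E = a.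
    by rewrite integral_cst//= probability_setT mule1.
  exact: (step 0%N (enorm (g y0 (0%:R * dt)) ^+ 2) (fun=> lexx _)).
have eS k : (0 < k)%N -> (e k.+1 <=
    ((1 - K1 * (dt / (1 + k%:R * dt))) ^+ 2)%:E * e k +
    (C ^+ 2 * M * (1 + k%:R * dt) `^ (- (2 * K1)))%:E)%E.
  move=> k0; set t := k%:R * dt.
  have t0 : 0 < t by rewrite mulr_gt0// ltr0n.
  have t10 : 0 <= (1 + t)^-1 by rewrite invr_ge0; lra.
  have gc x : enorm (g x t) ^+ 2 <= C ^+ 2 * (1 + t) `^ (- (2 * K1)).
    have [_ _ gx] := fg t x t0.
    rewrite -sqr_powRN -exprMn ler_sqr ?nnegrE ?sqrtr_ge0//.
    by rewrite mulr_ge0 ?powR_ge0// ltW.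
  have fq x : enorm (x + dt *: f x t) ^+ 2 <=
      (1 - K1 * (dt / (1 + t))) ^+ 2 * enorm x ^+ 2.
    have [f1 f2 _] := fg t x t0.
    have -> : K1 * (dt / (1 + t)) = K1 * (1 + t)^-1 * dt.
      by rewrite mulrA mulrAC.
    apply: sqr_enorm_drift_le => //.
    - by rewrite mulr_ge0// ltW.
    - exact: ltW.
    - by rewrite -mulNr.
  apply: le_trans (step k _ (fun=> gc _)) _.
  have -> : C ^+ 2 * M * (1 + t) `^ (- (2 * K1)) =
            C ^+ 2 * (1 + t) `^ (- (2 * K1)) * M by ring.
  apply: leeD2r.
  have := @euler_maruyama_contraction _ _ _ _ _ _ _ _ _ _ y0 k _ uF bB dt0
    lip (sqr_ge0 _) fq.
  exact.
set A := enorm _ ^+ 2 + _ in e1.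
have A0 : 0 <= A by apply: addr_ge0 (sqr_ge0 _) (mulr_ge0 (sqr_ge0 _) M0).
have c0 : 0 <= C ^+ 2 * M by exact: mulr_ge0 (sqr_ge0 _) M0.
have eb := linear_growth_powR_bound (ltW K10) c0 dt0 K1dt A0 e1 eS.
set q := (1 + dt) `^ (2 * K1) in eb.
have q0 : 0 <= q by exact: powR_ge0.
(* By k <= t_k / dt and 1 <= t_k the linear growth in k is bounded by a
   multiple of t_k; the final 1 makes M' positive. *)
pose M' := A * q + C ^+ 2 * M * q / dt + 1.
have [a0 b0] : 0 <= A * q /\ 0 <= C ^+ 2 * M * q / dt.
  split; first exact: mulr_ge0.
  by apply: divr_ge0 (ltW dt0); exact: mulr_ge0.
under eq_fun do rewrite unlock.
apply: (@limn_esup_ln_ratio_le _ e M') => //.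
- by rewrite /M'; lra.
- by lra.
move=> k k0; apply: le_trans (eb k k0) _; rewrite lee_fin.
set t := 1 + k%:R * dt.
have kdt0 : 0 <= k%:R * dt by rewrite mulr_ge0// ltW.
have t0 : 0 < t by rewrite /t; lra.
have -> : t `^ (- (2 * K1 - 1)) = t * t `^ (- (2 * K1)).
  have -> : - (2 * K1 - 1) = 1 + - (2 * K1) by ring.
  by rewrite powRD ?powRr1 ?(ltW t0)// (gt_eqF t0) implybT.
rewrite mulrA ler_wpM2r ?powR_ge0//.
have -> : C ^+ 2 * M * q * k%:R = C ^+ 2 * M * q / dt * (k%:R * dt).
  by field; rewrite gt_eqF.
rewrite /M' /t; nra.
Qed.
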